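(* For every integer $n > 0$, the set $\mathbb{M}_n$ of leading monomials of the elements of the reduced Gröbner basis of $J_n$ with respect to $\preceq$ coincides with $\mathcal{P}_n$.
   Context: Let $\sigma \subset \mathbb{R}^2$ be the cone generated by $(0,1)$ and $(4,-3)$; its dual $\sigma^\vee$ is generated by $(1,0)$ and $(3,4)$. Put $\sigma_{\mathbb{Z}} := \sigma^\vee \cap \mathbb{Z}^2$, a semigroup generated by $(1,0),(3,4),(1,1)$, and $S := \mathbb{C}[\sigma_{\mathbb{Z}}] = \mathbb{C}[u,u^3v^4,uv] \subset \mathbb{C}[u,v]$. A point $(a,b)\in\sigma_{\mathbb{Z}}$ is identified with the monomial $u^av^b \in S$. Divisibility of monomials of $S$ is always taken in $S$. For an integer $n>0$ let $J_n := \langle u-1,\, u^3v^4-1,\, uv-1\rangle^{n+1} \subset S$. Let $\preceq$ be the total ordering on monomials of $S$ associated to the matrix $\begin{pmatrix} 2 & -1 \\ 1 & 1\end{pmatrix}$: for $\alpha\neq\beta$ in $\sigma_{\mathbb{Z}}$, $\beta \prec \alpha$ iff $(2,-1)\cdot(\alpha-\beta)>0$, or $(2,-1)\cdot(\alpha-\beta)=0$ and $(1,1)\cdot(\alpha-\beta)>0$. It is a monomial ordering on $S$. For $0\ne f\in S$, $\mathrm{lm}_\preceq(f)$ and $\mathrm{lc}_\preceq(f)$ are the leading monomial and leading coefficient, and $\mathrm{supp}(f)$ is the set of monomials with nonzero coefficient in $f$. A Gröbner basis of an ideal $I$ is a finite set $\{g_1,\dots,g_t\}$ of nonzero elements of $I$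 such that for every $0\ne f\in I$ some $\mathrm{lm}_\preceq(g_i)$ divides $\mathrm{lm}_\preceq(f)$ in $S$; it is reduced if $\mathrm{lc}_\preceq(g_i)=1$ for all $i$ and no monomial of $\mathrm{supp}(g_i)$ is divisible by $\mathrm{lm}_\preceq(g_j)$ for $j\ne i$. Every nonzero ideal of $S$ has a unique reduced Gröbner basis. Let $\mathbb{G}_n$ be the set of pairs $(g,\mathrm{lm}_\preceq(g))$ with $g$ in the reduced Gröbner basis of $J_n$, and $\mathbb{M}_n := \{\alpha \mid (g,\alpha)\in\mathbb{G}_n\}$. For each integer $n>0$, $\mathcal{P}_n\subset\sigma_{\mathbb{Z}}$ is the set consisting of the following points $p_n$, all $q_n^i$, all $r_n^j$, and $s_n$. If $n$ is odd: $p_n := (\frac{n+3}{2},0)$; $q_n^0 := (\frac{n+3}{2},1)+\frac{n-1}{2}(1,2)$, $q_n^i := q_n^0 - i(1,2)$ for $0\le i\le \frac{n-1}{2}$; $r_n^0 := q_n^0+(0,1)$, $r_n^j := r_n^0 + j(1,2)$ for $0\le j\le\frac{n-1}{2}$; $s_n := \frac{n+1}{2}(3,4)$. If $n$ is even: $p_n := (\frac{n+2}{2},0)$; $q_n^0 := (\frac{n+2}{2},0)+\frac{n}{2}(1,2)$, $q_n^i := q_n^0 - i(1,2)$ for $0\le i\le\frac{n-2}{2}$; $r_n^0 := q_n^0+(0,1)$, $r_n^j := r_n^0+j(1,2)$ for $0\le j\le\frac{n}{2}$; $s_n := \frac{n+2}{2}(3,4)$. *)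

(* Defs.v *)
From HB Require Import structures.
From mathcomp Require Import all_boot all_order all_algebra.
From mathcomp Require Import finmap complex ring lra zify.
From mathcomp.multinomials Require Import monalg.
From mathcomp Require Export reals.

Set Implicit Arguments.
Unset Strict Implicit.
Unset Printing Implicit Defensive.

Import Order.TTheory GRing.Theory Num.Theory.
Local Open Scope ring_scope.

Definition dot (A : pzRingType) (x y : A * A) : A := x.1 * y.1 + x.2 * y.2.

Section Cones.
Variable F : realFieldType.

Definition cone (v w : F * F) (x : F * F) : Prop :=
  exists s t : F, [/\ 0 <= s, 0 <= t & x = (s * v.1 + t * w.1, s * v.2 + t * w.2)].

Definition dual_cone (C : F * F -> Prop) (y : F * F) : Prop :=
  forall x, C x -> 0 <= dot y x.

Definition sigma : F * F -> Prop := cone (0, 1) (4, -3).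

End Cones.

(* The lattice points of the dual of the cone sigma, as a decidable set: it is
   enough to pair with the two generators of sigma (see sigmaZP). *)
Definition sigmaZ : {pred int * int} :=
  [pred p | (0 <= dot p (0, 1)) && (0 <= dot p (4, -3))].

Lemma sigmaZE (p : int * int) :
  (p \in sigmaZ) = (0 <= p.2) && (3 * p.2 <= 4 * p.1).
Proof. by rewrite inE /dot /=; lia. Qed.

Lemma sigmaZP (F : realFieldType) (p : int * int) :
  reflect (dual_cone (@sigma F) (p.1%:~R, p.2%:~R)) (p \in sigmaZ).
Proof.
have dotE (x y : int) : p.1%:~R * x%:~R + p.2%:~R * y%:~R =
    (dot p (x, y))%:~R :> F by rewrite /dot /= intrD !intrM.
apply: (iffP idP) => [/andP[h1 h2] x [s [t [s0 t0 ->]]]|h].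
  have -> : dot (p.1%:~R, p.2%:~R) (s * 0 + t * 4, s * 1 + t * -3)
      = s * (dot p (0, 1))%:~R + t * (dot p (4, -3))%:~R :> F.
    by rewrite -!dotE /dot /=; ring.
  by rewrite addr_ge0 // mulr_ge0 // ler0z.
apply/andP; split; rewrite -(ler0z F) -dotE; apply: (h (_, _)).
  by exists 1, 0; split=> //; rewrite /= !mul0r !addr0 !mul1r.
by exists 0, 1; split=> //; rewrite /= !mul0r !add0r !mul1r.
Qed.

Lemma sigmaZ_gen (p : int * int) : p \in sigmaZ ->
  exists i j k : nat, p = (1, 0) *+ i + (3, 4) *+ j + (1, 1) *+ k.
Proof.
case: p => [] [a|a] [b|b]; rewrite sigmaZE /= => h; try lia.
exists (a - 3 * (b %/ 4) - b %% 4)%N, (b %/ 4)%N, (b %% 4)%N.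
rewrite !pairMnE /=; apply/eqP; rewrite xpair_eqE /=; lia.
Qed.

Record monom := Monom { monom_pt :> int * int; _ : monom_pt \in sigmaZ }.

HB.instance Definition _ := [isSub for monom_pt].
HB.instance Definition _ := [Choice of monom by <:].

Fact monom1_subproof : (0 : int * int) \in sigmaZ. Proof. by []. Qed.
Definition monom1 : monom := Monom monom1_subproof.

Fact monomM_subproof (a b : monom) : (a : int * int) + b \in sigmaZ.
Proof.
by have := valP a; have := valP b; rewrite !sigmaZE /=; lia.
Qed.
Definition monomM (a b : monom) : monom := Monom (monomM_subproof a b).

Fact monomMA : associative monomM.
Proof. by move=> a b c; apply/val_inj; rewrite /= addrA. Qed.
Fact monom1M : left_id monom1 monomM.
Proof. by move=> a; apply/val_inj; rewrite /= add0r. Qed.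
Fact monomM1 : right_id monom1 monomM.
Proof. by move=> a; apply/val_inj; rewrite /= addr0. Qed.
Fact monomMC : commutative monomM.
Proof. by move=> a b; apply/val_inj; rewrite /= addrC. Qed.
Fact monomM_unit (a b : monom) : monomM a b = monom1 -> a = monom1 /\ b = monom1.
Proof.
case: a b => [[a1 a2] ha] [[b1 b2] hb] [e1 e2].
have := ha; have := hb; rewrite !sigmaZE /= => ? ?.
by split; apply/val_inj/eqP; rewrite /= xpair_eqE; lia.
Qed.

HB.instance Definition _ := Choice_isMonomialDef.Build monom
  monomMA monom1M monomM1 monomM_unit.
HB.instance Definition _ := MonomialDef_isConomialDef.Build monom monomMC.

(* The semigroup algebra S = C[sigmaZ]; << a >> is the monomial u^a.1 v^a.2 and
   mcoeff, msupp are the coefficients and the support. *)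
Notation semigroup_algebra R := {malg R[i][monom]}.

Section Ideals.
Variable A : comNzRingType.

Definition divides (x y : A) : Prop := exists z, y = x * z.

Lemma divides_trans (x y z : A) : divides x y -> divides y z -> divides x z.
Proof. by move=> [u ->] [v ->]; exists (u * v); rewrite mulrA. Qed.

Definition ideal_gen (gs : seq A) (f : A) : Prop :=
  exists c : nat -> A, f = \sum_(i < size gs) c i * gs`_i.

Definition ideal_mul (I J : A -> Prop) (f : A) : Prop :=
  exists s : seq (A * A), (forall p, p \in s -> I p.1 /\ J p.2) /\
    f = \sum_(p <- s) p.1 * p.2.

Fixpoint ideal_exp (I : A -> Prop) (k : nat) : A -> Prop :=
  if k is k'.+1 then ideal_mul I (ideal_exp I k') else fun=> True.

End Ideals.

Definition prec (b a : int * int) : bool :=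
  (0 < dot (2, -1) (a - b)) ||
  (dot (2, -1) (a - b) == 0) && (0 < dot (1, 1) (a - b)).

Lemma prec_irr : irreflexive prec.
Proof. by move=> a; rewrite /prec subrr. Qed.

Lemma prec_trans : transitive prec.
Proof. by move=> [b1 b2] [a1 a2] [c1 c2]; rewrite /prec /dot /=; lia. Qed.

Lemma prec_total (a b : int * int) : [|| a == b, prec a b | prec b a].
Proof. by case: a b => [a1 a2] [b1 b2]; rewrite xpair_eqE /prec /dot /=; lia. Qed.

Lemma prec_add2r (c a b : int * int) : prec (a + c) (b + c) = prec a b.
Proof. by rewrite /prec opprD addrACA subrr addr0. Qed.

Lemma prec1 (a : monom) : a != monom1 -> prec monom1 a.
Proof.
rewrite -(inj_eq val_inj); have := valP a; rewrite sigmaZE /= /prec /dot.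
by case: (monom_pt a) => a1 a2; rewrite xpair_eqE /=; lia.
Qed.

Section LeadingMonomials.
Variable R : realType.
Local Notation S := (semigroup_algebra R).

(* lm 0 = 1 by convention. For f != 0 the initial value monom1 is harmless, as
   it is the least monomial (prec1): lm f is the greatest element of the support
   (lm_in and lm_max). *)
Definition prec_max (a b : monom) : monom := if prec a b then b else a.
Definition lm (f : S) : monom := \big[prec_max/monom1]_(a <- msupp f) a.
Definition lc (f : S) : R[i] := f@_(lm f).

Lemma prec_max_big (s : seq monom) :
  let m := \big[prec_max/monom1]_(a <- s) a in
  (s != [::] -> m \in s) /\ (forall a, a \in s -> a != m -> prec a m).
Proof.
elim: s => [|x s [IH1 IH2]] /=; first by rewrite big_nil.
rewrite big_cons; set m := \big[_/_]_(a <- s) a in IH1 IH2 *.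
rewrite /prec_max; case: ifP => [lt_xm|nlt_xm]; split.
- case: (eqVneq s [::]) => [s0 _|/IH1]; last by rewrite inE => ->; rewrite orbT.
  move: lt_xm; rewrite /m s0 big_nil => lt_x1.
  have [->|/prec1 lt_1x] := eqVneq x monom1; first by rewrite inE eqxx.
  by have := prec_trans lt_x1 lt_1x; rewrite prec_irr.
- by move=> a; rewrite inE => /orP[/eqP->//|]; apply: IH2.
- by rewrite inE eqxx.
- move=> a; rewrite inE => /orP[/eqP->|as_]; first by rewrite eqxx.
  have := prec_total x m; rewrite (inj_eq val_inj) nlt_xm /= => /orP[/eqP xm|lt_mx] ax.
    by rewrite xm; apply: IH2; rewrite -?xm.
  have [->//|/(IH2 _ as_) lt_am] := eqVneq a m.
  exact: prec_trans lt_am lt_mx.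
Qed.

Lemma lm_in (f : S) : f != 0 -> lm f \in msupp f.
Proof.
move=> f0; have [+ _] := prec_max_big (msupp f); apply.
apply: contraNneq f0 => s0; rewrite -msupp_eq0.
by apply/eqP/fsetP => a; rewrite inE -[a \in _]/(a \in (msupp f : seq _)) s0.
Qed.

Lemma lm_max (f : S) (a : monom) : a \in msupp f -> a != lm f -> prec a (lm f).
Proof. by have [_] := prec_max_big (msupp f); apply. Qed.

Definition mdivides (a b : monom) : Prop := @divides S << a >> << b >>.

Lemma mdividesP (a b : monom) : mdivides a b <-> exists c, b = mmul a c.
Proof.
split=> [[z e]|[c ->]]; last first.
  by exists << c >>; rewrite -[_ * _]/(fgmul _ _) fgmulUU mulr1.
have : b \in msupp (<< b >> : S) by rewrite msuppU oner_eq0 inE.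
rewrite {}e -[_ * _]/(fgmul _ _) fgmulUg -mcoeff_neq0 raddf_sum /= => nz.
case: (boolP (has (fun c => b == mmul a c) (msupp z))) => [/hasP[c _ /eqP->]|].
  by exists c.
move/hasPn=> nex; case/eqP: nz; rewrite big_seq big1 // => c /nex.
by rewrite mcoeffU eq_sym => /negPf->.
Qed.

Lemma mdivides_prec (a b : monom) : mdivides a b -> a != b -> prec a b.
Proof.
case/mdividesP=> c -> neq; rewrite -(prec_add2r (- (a : int * int))).
have -> : monom_pt (mmul a c) - monom_pt a = c by rewrite /= addrC addKr.
rewrite subrr; apply: prec1; apply: contraNneq neq => ->.
by apply/eqP/val_inj; rewrite /= addr0.
Qed.

Definition groebner_basis (I : S -> Prop) (G : {fset S}) : Prop :=
  (forall g, g \in G -> g != 0 /\ I g) /\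
  (forall f, f != 0 -> I f -> exists2 g, g \in G & mdivides (lm g) (lm f)).

Definition reduced_groebner_basis (I : S -> Prop) (G : {fset S}) : Prop :=
  [/\ groebner_basis I G,
      forall g, g \in G -> lc g = 1 &
      forall g h a, g \in G -> h \in G -> h != g -> a \in msupp g ->
        ~ mdivides (lm h) a].

Lemma reduced_groebner_basis_uniq (I : S -> Prop) (G G' : {fset S}) :
    (forall f g, I f -> I g -> I (f - g)) ->
  reduced_groebner_basis I G -> reduced_groebner_basis I G' -> G = G'.
Proof.
move=> IB; suff sub G1 G2 : reduced_groebner_basis I G1 ->
    reduced_groebner_basis I G2 -> forall g, g \in G1 -> g \in G2.
  by move=> hG hG'; apply/fsetP=> g; apply/idP/idP; apply: sub.
move=> [[I1 B1] c1 r1] [[I2 B2] c2 r2] g g1.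
have dvd_trans a b c : mdivides a b -> mdivides b c -> mdivides a c.
  exact: divides_trans.
have dvd_anti a b : mdivides a b -> mdivides b a -> a = b.
  move=> ab ba; have [//|neq] := eqVneq a b.
  have := prec_trans (mdivides_prec ab neq) (mdivides_prec ba _).
  by rewrite eq_sym prec_irr => /(_ neq).
have [g0 Ig] := I1 g g1; have [h h2 hg] := B2 g g0 Ig.
have [h0 Ih] := I2 h h2; have [k k1 kh] := B1 h h0 Ih.
have ekg : k = g.
  have [//|neq] := eqVneq k g.
  by case: (r1 g k (lm g) g1 k1 neq (lm_in g0)); apply: dvd_trans kh hg.
have elm : lm h = lm g by apply: dvd_anti hg _; rewrite -ekg.
have [->//|neq] := eqVneq g h.
have f0 : g - h != 0 by rewrite subr_eq0.
have If := IB _ _ Ig Ih.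
have nlm : lm (g - h) != lm g.
  apply/eqP=> e; have := lm_in f0; rewrite e -mcoeff_neq0 mcoeffB.
  by rewrite -/(lc g) c1 // -elm -/(lc h) c2 // subrr eqxx.
have /fsubsetP/(_ _ (lm_in f0)) := msuppB_le g h.
have [x x1 xf] := B1 _ f0 If; have [y y2 yf] := B2 _ f0 If.
rewrite in_fsetU => /orP[] insupp.
  have [exg|nxg] := eqVneq x g; last by case: (r1 _ _ _ g1 x1 nxg insupp).
  rewrite exg in xf; have lt_fg := lm_max insupp nlm; rewrite eq_sym in nlm.
  by have := prec_trans lt_fg (mdivides_prec xf nlm); rewrite prec_irr.
have [eyh|nyh] := eqVneq y h; last by case: (r2 _ _ _ h2 y2 nyh insupp).
rewrite eyh in yf; have nlm' : lm (g - h) != lm h by rewrite elm.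
have lt_fh := lm_max insupp nlm'; rewrite eq_sym in nlm'.
by have := prec_trans lt_fh (mdivides_prec yf nlm'); rewrite prec_irr.
Qed.

End LeadingMonomials.

Definition mon10 : monom := @Monom (1, 0) isT.
Definition mon34 : monom := @Monom (3, 4) isT.
Definition mon11 : monom := @Monom (1, 1) isT.

Section NashIdeal.
Variables (R : realType) (n : nat).
Local Notation S := (semigroup_algebra R).

Definition J : S -> Prop :=
  ideal_exp (ideal_gen [:: << mon10 >> - 1; << mon34 >> - 1; << mon11 >> - 1]) n.+1.

(* The reduced basis of J is unique, see reduced_groebner_basis_uniq and J_sub. *)
Definition GG (ga : S * monom) : Prop :=
  exists G : {fset S},
    [/\ reduced_groebner_basis J G, ga.1 \in G & ga.2 = lm ga.1].

Definition MM (a : int * int) : Prop := exists ga, GG ga /\ a = ga.2.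

Lemma J_sub (f g : S) : J f -> J g -> J (f - g).
Proof.
move=> [s [hs ->]] [t [ht ->]].
exists (s ++ [seq (- p.1, p.2) | p <- t]); split.
  move=> p; rewrite mem_cat => /orP[/hs//|/mapP[q /ht[[c hc] hJ] ->]]; split=> //.
  exists (fun i => - c i); rewrite /= hc -sumrN.
  by apply: eq_bigr => i _; rewrite mulNr.
rewrite big_cat big_map /=; congr (_ + _); rewrite -sumrN.
by apply: eq_bigr => p _; rewrite mulNr.
Qed.

End NashIdeal.

(* All the halvings below are exact. *)
Section Points.
Variable n : nat.

Definition pt (a b : nat) : int * int := (a%:Z, b%:Z).

Definition P_odd (a : int * int) : Prop :=
  let q0 := pt (n + 3)./2 1 + pt 1 2 *+ (n - 1)./2 in
  let r0 := q0 + pt 0 1 in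
  [\/ a = pt (n + 3)./2 0,
      exists2 i, (i <= (n - 1)./2)%N & a = q0 - pt 1 2 *+ i,
      exists2 j, (j <= (n - 1)./2)%N & a = r0 + pt 1 2 *+ j |
      a = pt 3 4 *+ (n + 1)./2].

Definition P_even (a : int * int) : Prop :=
  let q0 := pt (n + 2)./2 0 + pt 1 2 *+ n./2 in
  let r0 := q0 + pt 0 1 in
  [\/ a = pt (n + 2)./2 0,
      exists2 i, (i <= (n - 2)./2)%N & a = q0 - pt 1 2 *+ i,
      exists2 j, (j <= n./2)%N & a = r0 + pt 1 2 *+ j |
      a = pt 3 4 *+ (n + 2)./2].

Definition PP (a : int * int) : Prop := if odd n then P_odd a else P_even a.

End Points.

(* Main.v *)
Require Import Defs.
From mathcomp Require Import all_boot all_order all_algebra.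
From mathcomp Require Import finmap complex ring zify.
From mathcomp.multinomials Require Import monalg.
From mathcomp Require Import boolp.

(** Write x, y, z for the monomials (1,0), (1,1), (3,4), so that xz = y^4. The
    elements x - 1, z - 1, y - 1 generate the maximal ideal m of S at the unit
    of the torus, and J_n is m^(n+1).

    The main claim is that the monomials below y^(n+1) = (n+1,n+1) form a basis
    of S modulo J_n. They make up an initial segment of the monomial order, so
    the claim determines all leading monomials: those of J_n are exactly the
    monomials which are not below y^(n+1). The minimal ones for divisibility
    (the corners) are then the leading monomials of the reduced basis, whose
    elements are the differences between a corner and its normal form
    (reduced_basis_reduced), and comparing corners with P_n is elementary
    arithmetic (corner_PP).

    The claim becomes transparent in the coordinates j = b - a and k = 2a - b.
    Multiplication by y fixes j and adds 1 to k, and S is a free C[y]-module on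
    1, x, z, x^2, z^2, ..., whose terms start the lines j = 0, -1, 1, -2, 2, ...
    Number the lines in this order, from 0. The monomial at position t of line
    i is below y^(n+1) exactly when i + t <= n (standardE): line i carries
    n + 1 - i standard monomials.

    - Independence (J_standard_eq0). If a polynomial p has degree at most n,
      then the functional which sends each monomial to the value of p at its
      exponent kills m^(n+1), because multiplying by (monomial - 1) turns p
      into a finite difference of p. The products newton i t, of degree i + t,
      are triangular on the standard points: newton i t vanishes on the lines
      before i and on the first t points of line i, but not at (i,t). This is
      unisolvence of interpolation on points on lines with n+1, n, n-1, ...
      points.

    - Spanning (monomial_has_nf). The element x + z - 2 y^2 lies in m^2, since
      it is (y^2 - 1)^2 - (x - 1)(z - 1). Its powers, times x - 1 for the odd
      lines, give for each i an element D_i of m^i equal to the start of line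
      i plus terms on earlier lines (exists_line_leader). Then
      (y - 1)^(n+1-i) D_i for i <= n, and D_i for i > n, lie in J_n; modulo
      J_n they rewrite every nonstandard monomial of line i in terms of
      monomials on earlier lines or at earlier positions of line i. *)

Set Implicit Arguments.
Unset Strict Implicit.
Unset Printing Implicit Defensive.

Import Order.TTheory GRing.Theory Num.Theory.
Local Open Scope ring_scope.

(** * Powers of an ideal *)

Section IdealPowers.
Variables (A : comNzRingType) (gs : seq A).
Local Notation I := (ideal_gen gs).
Local Notation Iexp := (ideal_exp I).

Lemma ideal_genM x f : I f -> I (x * f).
Proof.
move=> [c ->]; exists (fun i => x * c i); rewrite big_distrr /=.
by apply: eq_bigr => i _; rewrite mulrA.
Qed.

Lemma mem_ideal_gen (i : nat) : (i < size gs)%N -> I gs`_i.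
Proof.
move=> lt_i; exists (fun j => (j == i)%:R).
rewrite (bigD1 (Ordinal lt_i)) //= eqxx mul1r big1 ?addr0 // => j.
by rewrite -val_eqE /= => /negPf->; rewrite mul0r.
Qed.

Lemma ideal_exp0 k : Iexp k 0.
Proof. by case: k => // k; exists [::]; split=> //; rewrite big_nil. Qed.

Lemma ideal_expD k f g : Iexp k f -> Iexp k g -> Iexp k (f + g).
Proof.
case: k => // k [s [hs ->]] [t [ht ->]]; exists (s ++ t); rewrite big_cat.
by split=> // p; rewrite mem_cat => /orP[/hs|/ht].
Qed.

Lemma ideal_expMl k x f : Iexp k f -> Iexp k (x * f).
Proof.
case: k => // k [s [hs ->]]; exists [seq (x * p.1, p.2) | p <- s]; split.
  by move=> p /mapP[q /hs[h1 h2] ->]; split=> //; apply: ideal_genM.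
by rewrite big_map big_distrr; apply: eq_bigr => p _; rewrite /= mulrA.
Qed.

Lemma ideal_expN k f : Iexp k f -> Iexp k (- f).
Proof. by rewrite -mulN1r; apply: ideal_expMl. Qed.

Lemma ideal_exp1 f : I f -> Iexp 1 f.
Proof.
move=> If; exists [:: (f, 1)]; rewrite big_seq1 mulr1; split=> // p.
by rewrite inE => /eqP->.
Qed.

Lemma ideal_expM a b f g : Iexp a f -> Iexp b g -> Iexp (a + b) (f * g).
Proof.
elim: a f => [|a IH] f; first by move=> _; apply: ideal_expMl.
move=> [s [hs ->]] Ig; exists [seq (p.1, p.2 * g) | p <- s]; split.
  by move=> p /mapP[q /hs[h1 h2] ->]; split=> //; apply: IH.
by rewrite big_map big_distrl; apply: eq_bigr => p _; rewrite /= -mulrA.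
Qed.

Lemma ideal_expX a c f : Iexp a f -> Iexp (a * c) (f ^+ c).
Proof.
move=> If; elim: c => [|c IH]; first by rewrite muln0.
by rewrite exprS mulnS; apply: ideal_expM.
Qed.

Lemma ideal_expS a b f : (b <= a)%N -> Iexp a f -> Iexp b f.
Proof.
move=> /subnK<-; elim: (a - b)%N f => // c IH f [s [hs ->]]; apply: IH.
rewrite big_seq; elim/big_ind: _ => [||p /hs[_ h2]].
- exact: ideal_exp0.
- exact: ideal_expD.
exact: ideal_expMl.
Qed.

End IdealPowers.

(** * Polynomial functionals on powers of the augmentation ideal *)

Definition shift_diff (g : int * int) (p : int * int -> int) a := p (a + g) - p a.

(** Having degree less than d, expressed by the vanishing of all d-fold
    differences: this is the form in which powers of an ideal consume it. *)
Fixpoint deg_lt d (p : int * int -> int) : Prop :=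
  if d is d'.+1 then forall g, deg_lt d' (shift_diff g p) else p = fun=> 0.

Lemma deg_ltD d p q : deg_lt d p -> deg_lt d q -> deg_lt d (fun a => p a + q a).
Proof.
elim: d p q => [|d IH] p q /=; first by move=> -> ->; apply/funext => a; rewrite addr0.
move=> hp hq g; have := IH _ _ (hp g) (hq g); congr (deg_lt _ _).
by apply/funext=> a; rewrite /shift_diff; ring.
Qed.

Lemma deg_ltZ d c p : deg_lt d p -> deg_lt d (fun a => c * p a).
Proof.
elim: d p => [|d IH] p /=; first by move=> ->; apply/funext => a; rewrite mulr0.
move=> hp g; have := IH _ (hp g); congr (deg_lt _ _).
by apply/funext=> a; rewrite /shift_diff; ring.
Qed.

Lemma deg_ltS d p : deg_lt d p -> deg_lt d.+1 p.
Proof.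
elim: d p => [|d IH] p => [-> g|hp g]; last by apply: IH; apply: hp.
by apply/funext => a; rewrite /shift_diff subrr.
Qed.

Lemma deg_ltW d e p : (d <= e)%N -> deg_lt d p -> deg_lt e p.
Proof. by move=> /subnK<- hp; elim: (e - d)%N => // c; apply: deg_ltS. Qed.

(** Leibniz rule: the difference of an affine function l times p along g is
    l times the difference of p, plus a constant times the shift of p by g,
    which is p plus its difference. *)
Lemma deg_lt_mul_affine d u v w p : deg_lt d p ->
  deg_lt d.+1 (fun a => (u * a.1 + v * a.2 + w) * p a).
Proof.
elim: d p => [|d IH] p hp g.
  by apply/funext => a; rewrite /shift_diff hp !mulr0 subrr.
have := deg_ltD (IH _ (hp g)) (deg_ltZ (u * g.1 + v * g.2) (deg_ltD (deg_ltS (hp g)) hp)).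
congr (deg_lt _ _); apply/funext => -[a1 a2]; case: g {IH hp} => g1 g2.
by rewrite /shift_diff /=; ring.
Qed.

Lemma deg_lt_prod_affine d k (u v : int) (w : nat -> int) p : deg_lt d p ->
  deg_lt (k + d) (fun a => (\prod_(i < k) (u * a.1 + v * a.2 + w i)) * p a).
Proof.
move=> hp; elim: k => [|k IH].
  by move: hp; congr (deg_lt _ _); apply/funext => a; rewrite big_ord0 mul1r.
have := deg_lt_mul_affine u v (w k) IH; congr (deg_lt _ _); apply/funext=> a.
by rewrite big_ord_recr /=; ring.
Qed.

Section Pairing.
Variable R : realType.
Local Notation S := (semigroup_algebra R).
Implicit Types (f g : S) (a b : monom).

Lemma monomial_mul a b : (<< a >> * << b >> : S) = << mmul a b >>.
Proof. by rewrite -[LHS]/(fgmul _ _) fgmulUU mulr1. Qed.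

Definition pairing (p : int * int -> int) : S -> R[i] :=
  mmap idfun (fun a : monom => (p a)%:~R).

Lemma pairingB p f g : pairing p (f - g) = pairing p f - pairing p g.
Proof. exact: raddfB. Qed.

Lemma pairing_sum p (T : Type) (r : seq T) (F : T -> S) :
  pairing p (\sum_(i <- r) F i) = \sum_(i <- r) pairing p (F i).
Proof. exact: raddf_sum. Qed.

(** Each factor (monomial - 1) costs one degree of p. *)
Lemma pairing_shift p a f : pairing p ((<< a >> - 1) * f) = pairing (shift_diff a p) f.
Proof.
rewrite [f in LHS]monalgE mulr_sumr pairing_sum [RHS]mmapE.
apply: eq_bigr => b _; rewrite mulrBl mul1r pairingB.
rewrite -[<< a >> * _]/(fgmul _ _) fgmulUU mul1r /pairing !mmapU -mulrBr -rmorphB.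
by rewrite /shift_diff /= (addrC (monom_pt b)).
Qed.

Lemma pairing_ideal_exp (ms : seq monom) d p f : deg_lt d p ->
  ideal_exp (ideal_gen [seq << m >> - 1 | m <- ms]) d f -> pairing p f = 0.
Proof.
elim: d p f => [|d IH] p f hp.
  by move=> _; rewrite [LHS]mmapE big1 // => a _; rewrite hp mulr0.
move=> [s [hs ->]]; rewrite pairing_sum big_seq big1 // => -[q h] /hs /= [[c ->] hh].
rewrite mulr_suml pairing_sum big1 // => -[i lt_i] _ /=; rewrite size_map in lt_i.
rewrite (nth_map monom1) // -mulrA mulrCA pairing_shift; apply: IH (hp _) _.
exact: ideal_expMl.
Qed.

End Pairing.

(** * Lines of monomials and linear independence modulo J *)

Definition line_index (a : int * int) : nat :=
  (if (a.1 <= a.2)%R then absz (a.2 - a.1) * 2 else (absz (a.1 - a.2) * 2).-1)%N.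

(** On the line j = b - a, the values of k = 2a - b start at 2|j|; this is
    k - 2|j|. *)
Definition line_pos (a : int * int) : nat :=
  absz (if a.1 <= a.2 then 4 * a.1 - 3 * a.2 else a.2).

(** The value of j = b - a on line i. *)
Definition offset (i : nat) : int := if odd i then - (i.+1)./2%:Z else (i./2)%:Z.

Definition standard (n : nat) (a : int * int) : bool := prec a (n.+1%:Z, n.+1%:Z).

Lemma offset_line_index (a : int * int) : a.2 - a.1 = offset (line_index a).
Proof.
case: a => x y; rewrite /line_index /offset /=.
by case: (lerP x y) => h; case: ifP; lia.
Qed.

Lemma offset_inj : injective offset.
Proof. by move=> i j; rewrite /offset; case: ifP; case: ifP; lia. Qed.

Lemma level_line_pos (a : int * int) : a \in sigmaZ ->
  2 * a.1 - a.2 = 2 * `|offset (line_index a)|%R + (line_pos a)%:Z.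
Proof.
case: a => x y; rewrite sigmaZE /line_index /line_pos /offset /= => h.
by case: (lerP x y) => ?; case: ifP; lia.
Qed.

Lemma line_pos_inj (a b : int * int) : a \in sigmaZ -> b \in sigmaZ ->
  line_index a = line_index b -> line_pos a = line_pos b -> a = b.
Proof.
move=> ha hb el ep; have := level_line_pos ha; have := level_line_pos hb.
have := offset_line_index a; have := offset_line_index b; rewrite el ep.
by case: a b {ha hb el ep} => [x y] [x' y'] /= *; apply/eqP; rewrite xpair_eqE; lia.
Qed.

Lemma eq_line_index (a b : int * int) : a.2 - a.1 = b.2 - b.1 -> line_index a = line_index b.
Proof. by rewrite !offset_line_index => /offset_inj. Qed.

Lemma ltn_line_pos (a b : int * int) : a \in sigmaZ -> b \in sigmaZ ->
  line_index a = line_index b -> 2 * a.1 - a.2 < 2 * b.1 - b.2 -> (line_pos a < line_pos b)%N.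
Proof. by move=> /level_line_pos-> /level_line_pos-> ->; lia. Qed.

(** The level k of a point on line i at position t is i + t on the lines j >= 0
    and i + t + 1 on the lines j < 0. The asymmetry matches the order: on level
    n + 1, the points below y^(n+1) are those with j < 0. *)
Lemma standardE n (a : int * int) : a \in sigmaZ ->
  standard n a = (line_index a + line_pos a <= n)%N.
Proof.
case: a => x y; rewrite sigmaZE /standard /prec /dot /line_index /line_pos /=.
by case: ifP => ? ?; lia.
Qed.

Lemma argmax_seq (T : eqType) (w : T -> nat) (s : seq T) : s != [::] ->
  exists2 x, x \in s & forall y, y \in s -> (w y <= w x)%N.
Proof.
elim: s => // x s IH _; case: (eqVneq s [::]) => [->|/IH [y ys hy]].
  by exists x => [|y]; rewrite ?inE // => /eqP->.
case: (leqP (w x) (w y)) => [le|lt]; [exists y|exists x]; rewrite ?inE ?eqxx ?ys ?orbT //.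
  by move=> z; rewrite inE => /orP[/eqP->|/hy].
move=> z; rewrite inE => /orP[/eqP->//|/hy le]; lia.
Qed.

(** The Newton basis adapted to the lines. The factors are spelled out as
    u a + v b + w to match deg_lt_prod_affine. *)
Definition newton (i t : nat) (a : int * int) : int :=
  ((\prod_(l < i) (-1 * a.1 + 1 * a.2 + - offset l)) *
  ((\prod_(s < t) (2 * a.1 + -1 * a.2 + - (2 * `|offset i| + s%:Z))) * 1))%R.

Lemma deg_lt_newton i t : deg_lt (i + t).+1 (newton i t).
Proof.
rewrite -addn1 -addnA.
apply: (deg_lt_prod_affine _ (-1) 1 (fun l => - offset l)).
apply: (deg_lt_prod_affine _ 2 (-1) (fun s => - (2 * `|offset i| + s%:Z))).
by move=> g; apply/funext => a; rewrite /shift_diff subrr.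
Qed.

Lemma newton_neq0 (a : int * int) : a \in sigmaZ -> newton (line_index a) (line_pos a) a != 0.
Proof.
move=> /level_line_pos lv; have ol := offset_line_index a; rewrite !mulf_neq0 //; apply/prodf_neq0.
  move=> [l lt_l] _ /=; apply/eqP => h; have : offset l = offset (line_index a) by lia.
  by move/offset_inj; lia.
by move=> [s lt_s] _ /=; apply/eqP; lia.
Qed.

Lemma newton_eq0 (a : int * int) i t : a \in sigmaZ ->
  (line_index a < i)%N || (line_index a == i) && (line_pos a < t)%N -> newton i t a = 0.
Proof.
move=> /level_line_pos lv; have ol := offset_line_index a.
case/orP => [lt_i|/andP[/eqP<- lt_t]]; apply/eqP; rewrite !mulf_eq0.
  apply/orP; left; apply/prodf_eq0; exists (Ordinal lt_i) => //=; apply/eqP; lia.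
apply/orP; right; apply/orP; left; apply/prodf_eq0.
by exists (Ordinal lt_t) => //=; apply/eqP; lia.
Qed.

Section Independence.
Variable R : realType.
Local Notation S := (semigroup_algebra R).

(** If f is nonzero, take the last point of its support in the lexicographic
    order of (line, position); the Newton function of that point extracts its
    coefficient from f, and kills f. *)
Lemma J_standard_eq0 n (f : S) : J n f -> (forall a, a \in msupp f -> standard n a) -> f = 0.
Proof.
move=> Jf hf; apply/eqP; rewrite -msupp_eq0; apply/negPn/negP => nz.
have nz' : (msupp f : seq monom) != [::].
  apply: contraNneq nz => s0.
  by apply/eqP/fsetP => a; rewrite inE -[a \in _]/(a \in (msupp f : seq _)) s0.
(* Standard points have position at most n, so that this weight encodes the
   lexicographic order. *)
have [a af amax] := argmax_seq (fun a : monom => line_index a * n.+1 + line_pos a)%N nz'.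
have := @pairing_ideal_exp R [:: mon10; mon34; mon11] n.+1 (newton (line_index a) (line_pos a)) f.
have la := valP a; have sa := hf a af; rewrite standardE // in sa.
move=> /(_ _ Jf) h.
have {h}: pairing (newton (line_index a) (line_pos a)) f = 0.
  by apply: h; apply: deg_ltW (deg_lt_newton _ _).
rewrite [pairing _ _]mmapE (perm_big _ (perm_to_rem af)) big_cons /=.
rewrite big_seq big1 ?addr0 => [/eqP|b].
  rewrite mulf_eq0 mcoeff_eq0 af /= intr_eq0.
  by rewrite (negPf (newton_neq0 la)).
rewrite mem_rem_uniq ?fset_uniq // inE => /andP[neq bf].
have lb := valP b; have sb := hf b bf; rewrite standardE // in sb.
rewrite newton_eq0 ?mulr0 //; have := amax _ bf.
have := line_pos_inj lb la; move: neq; rewrite -(inj_eq val_inj).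
case: (ltngtP (line_index b) (line_index a)) => //= [lt _ _|-> neq inj le]; first nia.
by rewrite ltn_neqAle; apply/andP; split; [apply: contraNneq neq => /inj->|lia].
Qed.

End Independence.

(** * Control of supports *)

Section Supports.
Variable R : realType.
Local Notation S := (semigroup_algebra R).
Implicit Types (f g : S) (a b : monom) (P : int * int -> Prop).

Definition supp_in P f := forall a, a \in msupp f -> P a.

Lemma supp_in_sub P P' f :
  (forall a : int * int, P a -> P' a) -> supp_in P f -> supp_in P' f.
Proof. by move=> sub hf a /hf/sub. Qed.

Lemma supp_in0 P : supp_in P 0.
Proof. by move=> a; rewrite msupp0 inE. Qed.

Lemma supp_inU P a : P a -> supp_in P << a >>.
Proof. by move=> Pa b; rewrite msuppU1 inE => /eqP->. Qed.

Lemma supp_inD P f g : supp_in P f -> supp_in P g -> supp_in P (f + g).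
Proof.
move=> hf hg a /(fsubsetP (msuppD_le f g)); rewrite in_fsetU.
by case/orP => [/hf|/hg].
Qed.

Lemma supp_inN P f : supp_in P f -> supp_in P (- f).
Proof. by move=> hf a; rewrite msuppN; apply: hf. Qed.

Lemma supp_inB P f g : supp_in P f -> supp_in P g -> supp_in P (f - g).
Proof. by move=> hf hg; apply: supp_inD => //; apply: supp_inN. Qed.

Lemma supp_in_sum P (T : eqType) (r : seq T) (F : T -> S) :
  (forall i, i \in r -> supp_in P (F i)) -> supp_in P (\sum_(i <- r) F i).
Proof.
move=> hF; rewrite big_seq; elim/big_ind: _ => //; first exact: supp_in0.
exact: supp_inD.
Qed.

Lemma supp_inZ P (c : R[i]) f : supp_in P f -> supp_in P (c *: f).
Proof.
move=> hf a; rewrite -mcoeff_neq0 mcoeffZ mulf_eq0 negb_or => /andP[_].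
by rewrite mcoeff_neq0; apply: hf.
Qed.

Lemma supp_inM P1 P2 P f g :
  (forall a b : int * int, P1 a -> P2 b -> P (a + b)) ->
  supp_in P1 f -> supp_in P2 g -> supp_in P (f * g).
Proof.
move=> h hf hg a /msuppM_le[b [c [/hf hb /hg hc ->]]]; exact: h.
Qed.

Lemma supp_in1 P : P 0 -> supp_in P 1.
Proof. exact: (@supp_inU P monom1). Qed.

Definition band (l h : int) (a : int * int) : Prop := l <= a.2 - a.1 <= h.

Lemma band_sub l h l' h' f : l' <= l -> h <= h' ->
  supp_in (band l h) f -> supp_in (band l' h') f.
Proof. by move=> ? ?; apply: supp_in_sub => -[a1 a2]; rewrite /band /=; lia. Qed.

Lemma bandM l h l' h' f g : supp_in (band l h) f -> supp_in (band l' h') g ->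
  supp_in (band (l + l') (h + h')) (f * g).
Proof.
by apply: supp_inM => -[a1 a2] [b1 b2]; rewrite /band /=; lia.
Qed.

Lemma bandX l h f k : supp_in (band l h) f ->
  supp_in (band (k%:Z * l) (k%:Z * h)) (f ^+ k).
Proof.
move=> hf; elim: k => [|k IH]; first by rewrite !mul0r; apply: supp_in1.
by rewrite exprS; apply: band_sub _ _ (bandM hf IH); rewrite intS mulrDl mul1r.
Qed.

(** Since f^(k+1) - g^(k+1) is f - g times a form of degree k in f and g, a
    gain on the band of f - g is not lost by taking powers. *)
Lemma bandXB l h f g k (l' h' : int) :
    supp_in (band l h) f -> supp_in (band l h) g -> supp_in (band l' h') (f - g) ->
  supp_in (band (k%:Z * l + l') (k%:Z * h + h')) (f ^+ k.+1 - g ^+ k.+1).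
Proof.
move=> hf hg hfg; rewrite subrXX; have -> : k%:Z * l + l' = l' + k%:Z * l by ring.
have -> : k%:Z * h + h' = h' + k%:Z * h by ring.
apply: bandM => //; apply: supp_in_sum => -[i lt_i] _ /=.
by apply: band_sub _ _ (bandM (bandX hf) (bandX hg)); rewrite -mulrDl -PoszD subnK.
Qed.

(** The supports of the polynomials in y of degree less than m. *)
Definition diag (m : nat) (a : int * int) : Prop := a.1 = a.2 /\ 0 <= a.1 < m%:Z.

Lemma diagM l m k f g : (l + m <= k.+1)%N ->
  supp_in (diag l) f -> supp_in (diag m) g -> supp_in (diag k) (f * g).
Proof. by move=> ?; apply: supp_inM => -[a1 a2] [b1 b2]; rewrite /diag /=; lia. Qed.

Lemma diagX m f : supp_in (diag 2) f -> supp_in (diag m.+1) (f ^+ m).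
Proof.
by move=> hf; elim: m => [|m IH]; [apply: supp_in1 | rewrite exprS; apply: diagM hf IH; lia].
Qed.

Lemma diagXB m f g : supp_in (diag 2) f -> supp_in (diag 2) g ->
  supp_in (diag 1) (f - g) -> supp_in (diag m) (f ^+ m - g ^+ m).
Proof.
move=> hf hg hfg; rewrite subrXX; apply: diagM hfg _; first exact: leqnn.
apply: supp_in_sum => -[i lt_i] _ /=.
by apply: diagM (diagX hf) (diagX hg); lia.
Qed.

End Supports.

(** * Normal forms modulo J *)

Section NormalForms.
Variables (R : realType).
Local Notation S := (semigroup_algebra R).
Local Notation x := (<< mon10 >> : S).
Local Notation y := (<< mon11 >> : S).
Local Notation z := (<< mon34 >> : S).
Local Notation mexp := (ideal_exp (ideal_gen [:: x - 1; z - 1; y - 1])).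

Lemma monomial_exp (a : monom) k :
  exists2 b : monom, (<< a >> : S) ^+ k = << b >> & monom_pt b = (k%:Z * a.1, k%:Z * a.2).
Proof.
elim: k => [|k [b e eb]]; first by exists monom1; rewrite // !mul0r.
exists (mmul a b); first by rewrite exprS e monomial_mul.
by rewrite /= eb intS !mulrDl !mul1r.
Qed.

Lemma xz_eq : x * z = y ^+ 4.
Proof.
have [b -> eb] := monomial_exp mon11 4; rewrite monomial_mul; congr << _ >>.
by apply/val_inj; rewrite [RHS]eb.
Qed.

Definition line_start (i : nat) : S := if odd i then x ^+ i.+1./2 else z ^+ i./2.

Lemma line_start_monomial (a : monom) : exists2 b : monom,
  line_start (line_index a) = << b >> & monom_pt a = (b.1 + (line_pos a)%:Z, b.2 + (line_pos a)%:Z).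
Proof.
have lv := level_line_pos (valP a); rewrite -[\val a]/(monom_pt a) in lv.
have ol := offset_line_index a.
rewrite /line_start; move: ol lv; rewrite /offset; case: ifP => odd_i ol lv.
  have [c -> ec] := monomial_exp mon10 (line_index a).+1./2; exists c => //; rewrite ec.
  by case: (monom_pt a) ol lv => u v /= *; apply/eqP; rewrite xpair_eqE /=; lia.
have [c -> ec] := monomial_exp mon34 (line_index a)./2; exists c => //; rewrite ec.
by case: (monom_pt a) ol lv => u v /= *; apply/eqP; rewrite xpair_eqE /=; lia.
Qed.

Lemma monomial_line_pos (a : monom) : << a >> = y ^+ line_pos a * line_start (line_index a).
Proof.
have [b -> eb] := line_start_monomial a.
have [c -> ec] := monomial_exp mon11 (line_pos a); rewrite monomial_mul.
congr << _ >>; apply/val_inj; rewrite [RHS]/= ec [LHS]eb.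
by apply/eqP; rewrite xpair_eqE /=; lia.
Qed.

(** A second-order element all of whose terms have level k = 2. On the torus it
    is y^2 w^(-1) (w - 1)^2, where w = (1,2) generates the points of level 0. *)
Definition quadric : S := x + z - y ^+ 2 *+ 2.

Lemma mexp_x : mexp 1 (x - 1). Proof. exact/ideal_exp1/(@mem_ideal_gen _ _ 0). Qed.
Lemma mexp_z : mexp 1 (z - 1). Proof. exact/ideal_exp1/(@mem_ideal_gen _ _ 1). Qed.
Lemma mexp_y : mexp 1 (y - 1). Proof. exact/ideal_exp1/(@mem_ideal_gen _ _ 2). Qed.

Lemma mexp_quadric : mexp 2 quadric.
Proof.
have -> : quadric = (y + 1) ^+ 2 * (y - 1) ^+ 2 - (x - 1) * (z - 1).
  rewrite /quadric; move: xz_eq; move: x y z => x y z xz.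
  have -> : (x - 1) * (z - 1) = y ^+ 4 - x - z + 1 by rewrite -xz; ring.
  by ring.
apply: ideal_expD.
  exact/ideal_expMl/(@ideal_expX _ _ 1 2)/mexp_y.
exact/ideal_expN/(ideal_expM mexp_x mexp_z).
Qed.

Lemma band_y2 l h : l <= 0 -> 0 <= h -> supp_in (band l h) (y ^+ 2 *+ 2).
Proof.
move=> ? ?; rewrite mulr2n; apply: supp_inD;
by apply: band_sub _ _ (@bandX _ 0 0 y 2 _); rewrite ?mulr0 //; apply: supp_inU.
Qed.

Lemma band_quadric : supp_in (band (-1) 1) quadric.
Proof. by apply: supp_inB (band_y2 _ _) => //; apply: supp_inD; apply: supp_inU. Qed.

Lemma expr_mulB1 (A : comNzRingType) (q t : A) c :
  q ^+ c * (t - 1) - t ^+ c.+1 = (q ^+ c - t ^+ c) * t - q ^+ c.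
Proof. by rewrite exprS; ring. Qed.

Lemma leader_split (A : comNzRingType) (p w v d b : A) :
  p * (w * d) - p * v * b = p * ((w - v) * b) + p * (w * (d - b)).
Proof. by ring. Qed.

(** The leader is quadric^c for i = 2c and quadric^c (x - 1) for i = 2c + 1. In
    the even case z is the only term of quadric on j = 1, which isolates z^c as
    the only term on j = c; in the odd case x is the only one on j = -1. *)
Lemma exists_line_leader i : exists2 D : S, mexp i D &
  supp_in (fun a => (line_index a < i)%N) (D - line_start i).
Proof.
rewrite /line_start; case: ifP => odd_i.
  have -> : i = (i./2 * 2 + 1)%N by lia.
  move: i./2 => c {i odd_i}; exists (quadric ^+ c * (x - 1)).
    by apply: ideal_expM mexp_x; rewrite mulnC; apply: ideal_expX mexp_quadric.
  have -> : (c * 2 + 1).+1./2 = c.+1 by lia.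
  apply: (@supp_in_sub _ (band (- c%:Z) c%:Z)).
    by move=> [u v]; rewrite /band /line_index /=; case: (lerP u v) => ?; lia.
  have -> : quadric ^+ c * (x - 1) - x ^+ c.+1 = (quadric ^+ c - x ^+ c) * x - quadric ^+ c.
    exact: expr_mulB1.
  apply: supp_inB; last by apply: band_sub _ _ (bandX band_quadric); lia.
  case: c => [|c]; first by rewrite !expr0 subrr mul0r; apply: supp_in0.
  have hx : supp_in (band (-1) (-1)) x by apply: supp_inU.
  have hx' : supp_in (band (-1) 1) x by apply: supp_inU.
  have hd : supp_in (band 0 1) (quadric - x).
    have -> : quadric - x = z - y ^+ 2 *+ 2 by rewrite /quadric; move: x y z => p q r; ring.
    by apply: supp_inB; [apply: supp_inU | apply: band_y2].
  by apply: band_sub _ _ (bandM (bandXB band_quadric hx' hd) hx); lia.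
have -> : i = (i./2 * 2)%N by lia.
move: i./2 => c {i odd_i}; exists (quadric ^+ c).
  by rewrite mulnC; apply: ideal_expX mexp_quadric.
have -> : (c * 2)./2 = c by lia.
case: c => [|c]; first by rewrite !expr0 subrr; apply: supp_in0.
apply: (@supp_in_sub _ (band (- c.+1%:Z) c%:Z)).
  by move=> [u v]; rewrite /band /line_index /=; case: (lerP u v) => ?; lia.
have hz : supp_in (band (-1) 1) z by apply: supp_inU.
have hd : supp_in (band (-1) 0) (quadric - z).
  have -> : quadric - z = x - y ^+ 2 *+ 2 by rewrite /quadric; move: x y z => p q r; ring.
  by apply: supp_inB; [apply: supp_inU | apply: band_y2].
by apply: band_sub _ _ (bandXB band_quadric hz hd); lia.
Qed.

Variable n : nat.

Definition has_nf (f : S) := exists2 r, J n (f - r) & supp_in (standard n) r.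

Lemma has_nf_J f : J n f -> has_nf f.
Proof. by move=> Jf; exists 0; rewrite ?subr0 //; apply: supp_in0. Qed.

Lemma has_nfB f g : has_nf f -> has_nf g -> has_nf (f - g).
Proof.
move=> [r hr sr] [s hs ss]; exists (r - s); last exact: supp_inB.
have -> : f - g - (r - s) = f - r - (g - s) by ring.
exact: (J_sub hr hs).
Qed.

(** Supports are constrained through points of the plane, hence the quantifier
    over the monomials b with exponent a. *)
Lemma has_nf_supp f :
  supp_in (fun a => forall b : monom, monom_pt b = a -> has_nf << b >>) f ->
  has_nf f.
Proof.
move=> hf; rewrite [f]monalgE big_seq; elim/big_ind: _ => [|g h hg hh|a /hf/(_ a erefl)].
- exact/has_nf_J/ideal_exp0.
- rewrite -[h]opprK; apply: has_nfB => //; rewrite -[- h]sub0r.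
  by apply: has_nfB => //; apply/has_nf_J/ideal_exp0.
move=> [r hr sr]; exists (f@_a *: r); last exact: supp_inZ.
have -> : << f@_a *g a >> - f@_a *: r = (f@_a)%:MP * (<< a >> - r).
  rewrite mulrBr !mul_malgC; congr (_ - _).
  by apply/malgP => b; rewrite mcoeffZ !mcoeffU mulr_natr.
exact: (ideal_expMl _ hr).
Qed.

(** Induction on the line, then on the position. A nonstandard monomial on line
    i is the term furthest along of y^(t-e) (y - 1)^e D, where D leads line i,
    t is its position and e = max(0, n + 1 - i); this product lies in J, and its
    other terms are on earlier lines or at earlier positions. *)
Lemma monomial_has_nf (a : monom) : has_nf << a >>.
Proof.
have [l] := ubnP (line_index a); elim: l a => // l IHl a; rewrite ltnS => le_l.
have [t] := ubnP (line_pos a); elim: t a le_l => // t IHt a le_l; rewrite ltnS => le_t.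
case: (boolP (standard n a)) => [sa|].
  by exists << a >>; [rewrite subrr; apply: ideal_exp0 | apply: supp_inU].
have la := valP a; rewrite standardE // -ltnNge => gt_n.
have [D hD sD] := exists_line_leader (line_index a).
pose e := (n.+1 - line_index a)%N; have le_e : (e <= line_pos a)%N by rewrite /e; lia.
set h := y ^+ (line_pos a - e) * ((y - 1) ^+ e * D).
have Jh : J n h.
  apply: ideal_expMl; apply: ideal_expS (ideal_expM (ideal_expX e mexp_y) hD).
  by rewrite /e mul1n; lia.
have -> : << a >> = h - (h - << a >>) :> S by rewrite subKr.
apply: has_nfB; first exact: has_nf_J.
have -> : h - << a >> =
    y ^+ (line_pos a - e) * (((y - 1) ^+ e - y ^+ e) * line_start (line_index a)) +
    y ^+ (line_pos a - e) * ((y - 1) ^+ e * (D - line_start (line_index a))).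
  rewrite /h (monomial_line_pos a) -[in y ^+ line_pos a](subnK le_e) exprD.
  exact: leader_split.
have [b0 -> vb0] := monomial_exp mon11 (line_pos a - e).
have [b1 eb1 vb1] := line_start_monomial a.
have hy : supp_in (diag 2) y by apply: supp_inU.
have hy1 : supp_in (diag 2) (y - 1) by apply: supp_inB => //; apply: supp_in1.
apply: has_nf_supp; apply: supp_inD.
  rewrite eb1; have hd : supp_in (diag 1) (y - 1 - y).
    by rewrite addrAC subrr sub0r; apply: supp_inN; apply: supp_in1.
  apply: (@supp_inM R (eq (monom_pt b0)) (fun c => diag e (c - monom_pt b1))).
  - move=> _ c <- hc b eb.
    have {hc}[hc1 hc2] : c.1 - b1.1 = c.2 - b1.2 /\ 0 <= c.1 - b1.1 < e%:Z by [].
    have [a1 a2] := (congr1 fst vb1, congr1 snd vb1); rewrite /= in a1 a2.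
    have [c1 c2] : b.1 = (line_pos a - e)%N%:Z + c.1 /\ b.2 = (line_pos a - e)%N%:Z + c.2.
      by rewrite eb vb0 /= !mulr1.
    have eql : line_index b = line_index a by apply: eq_line_index; lia.
    apply: IHt; first by rewrite eql.
    have ltl : 2 * b.1 - b.2 < 2 * a.1 - a.2 by lia.
    exact: leq_trans (ltn_line_pos (valP b) la eql ltl) le_t.
  - exact: supp_inU.
  apply: (@supp_inM R (diag e) (eq (monom_pt b1))); last exact: supp_inU.
    by move=> c _ hc <-; rewrite addrK.
  exact: diagXB.
apply: (@supp_inM R (eq (monom_pt b0)) (fun c => line_index c < line_index a)%N).
- move=> _ c <- lt_c b eb; apply: IHl; apply: leq_trans _ le_l.
  rewrite (@eq_line_index b c) // eb vb0 /= !mulr1; lia.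
- exact: supp_inU.
apply: (@supp_inM R (diag e.+1) (fun c => line_index c < line_index a)%N) sD; last exact: diagX.
by move=> [u v] c [/= -> _]; rewrite (@eq_line_index (_ + c) c) //=; lia.
Qed.

End NormalForms.

(** * Corners: minimal nonstandard monomials *)

(** Multiples of nonstandard monomials are nonstandard, so removing single
    generators is enough to test minimality for divisibility. *)
Definition corner (n : nat) (a : int * int) : bool :=
  [&& a \in sigmaZ, ~~ standard n a &
      all (fun g => (a - g \in sigmaZ) ==> standard n (a - g)) [:: (1, 0); (3, 4); (1, 1)]].

Lemma sigmaZ_sub_gen (a : int * int) : a \in sigmaZ -> a != 0 ->
  exists2 g, g \in [:: (1, 0); (3, 4); (1, 1)] & a - g \in sigmaZ.
Proof.
case: a => u v; rewrite sigmaZE -[(u, v) == 0]/((u, v) == (0, 0)) xpair_eqE /= => sa nz.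
case: (boolP (v == 0)) => v0; first by exists (1, 0) => //; rewrite sigmaZE /=; lia.
case: (boolP (3 * v == 4 * u)) => uv.
  by exists (3, 4) => //; rewrite sigmaZE /=; lia.
by exists (1, 1) => //; rewrite sigmaZE /=; lia.
Qed.

Lemma standard_mdivides (R : realType) n (a b : monom) :
  mdivides R a b -> standard n b -> standard n a.
Proof.
move=> ab sb; case: (eqVneq a b) => [->//|neq].
exact: prec_trans (mdivides_prec ab neq) sb.
Qed.

Lemma mdivides_sub (R : realType) (a b : monom) :
  monom_pt b - monom_pt a \in sigmaZ -> mdivides R a b.
Proof.
move=> h; apply/mdividesP; exists (Monom h); apply/val_inj => /=.
by rewrite addrC subrK.
Qed.

(** Removing generators from a nonstandard monomial, as long as it stays
    nonstandard, ends at a corner, because the level 2a - b decreases. *)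
Lemma corner_mdivides (R : realType) n (a : monom) : ~~ standard n a ->
  exists2 b : monom, corner n b & mdivides R b a.
Proof.
have [l] := ubnP (absz (2 * a.1 - a.2)%R); elim: l a => // l IH a le_l nsa.
have la := valP a.
case: (boolP (corner n a)) => [ca|].
  by exists a => //; apply/mdividesP; exists monom1; apply/val_inj; rewrite /= addr0.
rewrite /corner [monom_pt a \in _]la nsa 2!andTb => /allPn[g gin].
rewrite negb_imply => /andP[lag nsag].
have [|b cb ba] := IH (Monom lag) _ nsag.
  have := lag; move: la le_l; rewrite !sigmaZE /= -[\val a]/(monom_pt a).
  by move: gin; rewrite !inE => /or3P[] /eqP-> /=; lia.
exists b => //; apply: divides_trans ba _; apply: mdivides_sub.
move: gin; rewrite /= subKr !inE => /or3P[] /eqP-> //.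
Qed.

(** If b = a c with c <> 1, then c contains a generator; removing it from b
    leaves a multiple of a, which is not standard as a is not. *)
Lemma corner_antichain (R : realType) n (a b : monom) :
  corner n a -> corner n b -> mdivides R a b -> a = b.
Proof.
move=> /and3P[_ nsa _] /and3P[_ _ /allP hb] /mdividesP[c ebc].
have lc := valP c.
case: (eqVneq (monom_pt c) 0) => [c0|nz].
  by apply/val_inj; rewrite ebc /= c0 addr0.
have [g gin lcg] := sigmaZ_sub_gen lc nz.
have e : monom_pt b - g = mmul a (Monom lcg) by rewrite ebc /= addrA.
have := hb g gin; rewrite e => /implyP /(_ (valP _)) sd; case/negP: nsa.
by apply: (@standard_mdivides R) sd; apply/mdividesP; exists (Monom lcg).
Qed.

Lemma corner_bound n (a : int * int) : corner n a ->
  [/\ 0 <= a.1, a.1 < (2 * n + 7)%N%:Z, 0 <= a.2 & a.2 < (2 * n + 7)%N%:Z].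
Proof.
case: a => u v; rewrite /corner /= !sigmaZE /standard /prec /dot /= => h.
by split; lia.
Qed.

Lemma pt_mulrn a b k : pt a b *+ k = pt (a * k) (b * k).
Proof.
elim: k => [|k IH]; first by rewrite !muln0.
by rewrite mulrS IH; apply/eqP; rewrite xpair_eqE /=; lia.
Qed.

(** The second family of P_n runs on the level k = n + 2 down from (n+1,n), and
    the third on the level k = n + 1 up from (n+1,n+1), both along (1,2). Hence
    the point (u,v) has parameter n + 1 - u, respectively u - (n + 1). *)
Lemma corner_PP n (a : int * int) : (0 < n)%N -> corner n a <-> PP n a.
Proof.
(* Quantifier-free arithmetic, with the disjuncts in the order of the families
   of P_n. *)
case: a => u v n_gt0; have -> : corner n (u, v) = [&& 0 <= v, 3 * v <= 4 * u &
  if odd n then [|| (2 * u == n%:Z + 3) && (v == 0),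
    [&& 2 * u - v == n%:Z + 2, n%:Z + 3 <= 2 * u & u <= n%:Z + 1],
    [&& 2 * u - v == n%:Z + 1, n%:Z + 1 <= u & 2 * u <= 3 * n%:Z + 1] |
    (2 * u == 3 * (n%:Z + 1)) && (v == 2 * (n%:Z + 1))]
  else [|| (2 * u == n%:Z + 2) && (v == 0),
    [&& 2 * u - v == n%:Z + 2, n%:Z + 4 <= 2 * u & u <= n%:Z + 1],
    [&& 2 * u - v == n%:Z + 1, n%:Z + 1 <= u & 2 * u <= 3 * n%:Z + 2] |
    (2 * u == 3 * (n%:Z + 2)) && (v == 2 * (n%:Z + 2))]].
  by rewrite /corner /= !sigmaZE /standard /prec /dot /=; case: ifP => odd_n; lia.
rewrite /PP /P_odd /P_even !pt_mulrn; case: ifP => odd_n; split.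
- move=> /and3P[v0 uv /or4P[] h].
  + by apply: Or41; apply/eqP; rewrite xpair_eqE; lia.
  + apply: Or42; exists (n.+1 - absz u)%N; rewrite ?pt_mulrn; first lia.
    by apply/eqP; rewrite xpair_eqE /=; lia.
  + apply: Or43; exists (absz u - n.+1)%N; rewrite ?pt_mulrn; first lia.
    by apply/eqP; rewrite xpair_eqE /=; lia.
  by apply: Or44; apply/eqP; rewrite xpair_eqE; lia.
- by case=> [|[k le_k]|[k le_k]|]; rewrite ?pt_mulrn => /eqP; rewrite xpair_eqE /= => h; lia.
- move=> /and3P[v0 uv /or4P[] h].
  + by apply: Or41; apply/eqP; rewrite xpair_eqE; lia.
  + apply: Or42; exists (n.+1 - absz u)%N; rewrite ?pt_mulrn; first lia.
    by apply/eqP; rewrite xpair_eqE /=; lia.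
  + apply: Or43; exists (absz u - n.+1)%N; rewrite ?pt_mulrn; first lia.
    by apply/eqP; rewrite xpair_eqE /=; lia.
  by apply: Or44; apply/eqP; rewrite xpair_eqE; lia.
by case=> [|[k le_k]|[k le_k]|]; rewrite ?pt_mulrn => /eqP; rewrite xpair_eqE /= => h; lia.
Qed.

(** * The reduced basis *)

Section ReducedBasis.
Variables (R : realType) (n : nat).
Local Notation S := (semigroup_algebra R).

Definition corners : seq monom :=
  [seq a : monom <- pmap insub [seq (x%:Z, y%:Z) | x <- iota 0 (2 * n + 7), y <- iota 0 (2 * n + 7)]
  | corner n a].

Lemma mem_corners (a : monom) : (a \in corners) = corner n a.
Proof.
rewrite mem_filter andb_idr // => /corner_bound[u0 un v0 vn].
rewrite mem_pmap_sub; apply/allpairsP; exists (absz a.1, absz a.2).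
rewrite !mem_iota /=; split; [lia|lia|].
by rewrite -[\val a]/(monom_pt a) [LHS]surjective_pairing; congr pair; lia.
Qed.

Lemma lm_eq (f : S) (a : monom) : a \in msupp f ->
  (forall b, b \in msupp f -> b != a -> prec b a) -> lm f = a.
Proof.
move=> af fa; apply/eqP/negPn/negP => neq.
have f0 : f != 0 by apply: contraTneq af => ->; rewrite msupp0 inE.
have lt1 := fa _ (lm_in f0) neq; rewrite eq_sym in neq.
by have := prec_trans lt1 (lm_max af neq); rewrite prec_irr.
Qed.

(** The standard monomials form an initial segment: if the leading monomial is
    standard, then so is the whole support. *)
Lemma J_lm_nonstandard (f : S) : J n f -> f != 0 -> ~~ standard n (lm f).
Proof.
move=> Jf; apply: contraNN => s_lm; apply/eqP/(J_standard_eq0 Jf) => a af.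
by case: (eqVneq a (lm f)) => [->//|/(lm_max af) lt]; apply: prec_trans lt s_lm.
Qed.

Variable r : monom -> S.
Hypothesis J_r : forall a : monom, J n (<< a >> - r a).
Hypothesis r_std : forall a, supp_in (standard n) (r a).

Local Notation g a := (<< a >> - r a).

Lemma msupp_reduced (a b : monom) : b \in msupp (g a) -> b = a \/ standard n b.
Proof.
move/(fsubsetP (msuppB_le _ _)); rewrite in_fsetU msuppU1 inE.
by case/orP => [/eqP|/r_std]; [left|right].
Qed.

Lemma mcoeff_reduced (a : monom) : ~~ standard n a -> (g a)@_a = 1.
Proof.
move=> nsa; rewrite mcoeffB mcoeffUU mcoeff_outdom ?subr0 //.
by apply: contraNN nsa => /r_std.
Qed.

(** A nonstandard monomial exceeds every standard one, hence every term of its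
    normal form. *)
Lemma lm_reduced (a : monom) : ~~ standard n a -> lm (g a) = a.
Proof.
move=> nsa; apply: lm_eq.
  by rewrite -mcoeff_neq0 mcoeff_reduced ?oner_eq0.
move=> b /msupp_reduced[->|sb _]; first by rewrite eqxx.
have := prec_total b a; case: (eqVneq (monom_pt b) a) => [e|_ /= /orP[//|lt_ab]].
  by rewrite -e sb in nsa.
by rewrite /standard (prec_trans lt_ab sb) in nsa.
Qed.

Definition reduced_basis : {fset S} := [fset h in [seq g a | a <- corners]]%fset.

Lemma reduced_basisP h : reflect (exists2 a : monom, corner n a & h = g a) (h \in reduced_basis).
Proof.
rewrite in_fset; apply: (iffP mapP) => -[a ca ->]; exists a => //.
  by rewrite -mem_corners.
by rewrite mem_corners.
Qed.

Lemma corner_nonstandard (a : int * int) : corner n a -> ~~ standard n a.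
Proof. by case/and3P. Qed.

Lemma reduced_basis_reduced : reduced_groebner_basis (J (R := R) n) reduced_basis.
Proof.
split; first split.
- move=> _ /reduced_basisP[a /corner_nonstandard nsa ->]; split; last exact: J_r.
  by apply: contraTneq (oner_neq0 R[i]) => e; rewrite -(mcoeff_reduced nsa) e mcoeff0 eqxx.
- move=> f f0 Jf; have [a ca af] := corner_mdivides R (J_lm_nonstandard Jf f0).
  exists (g a); first by apply/reduced_basisP; exists a.
  by rewrite lm_reduced // corner_nonstandard.
- move=> _ /reduced_basisP[a /corner_nonstandard nsa ->].
  by rewrite /lc lm_reduced // mcoeff_reduced.
move=> _ _ c /reduced_basisP[a ca ->] /reduced_basisP[b cb ->] neq /msupp_reduced.
rewrite lm_reduced ?corner_nonstandard // => -[->|sc] dvd.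
  by rewrite (corner_antichain cb ca dvd) eqxx in neq.
by have := corner_nonstandard cb; rewrite (standard_mdivides dvd sc).
Qed.

End ReducedBasis.

Theorem proposition2p14 (R : realType) (n : nat) (n_gt0 : (0 < n)%N) :
  forall a : int * int, MM R n a <-> PP n a.
Proof.
move=> a; rewrite -corner_PP //.
have /choice[r hr] : forall a : monom, exists r : semigroup_algebra R,
    J n (<< a >> - r) /\ supp_in (standard n) r.
  by move=> b; have [r] := monomial_has_nf R n b; exists r.
have J_r b := (hr b).1; have r_std b := (hr b).2.
have red := reduced_basis_reduced J_r r_std.
split.
  move=> [[f m] [[G [redG /= fG ->]] ->]].
  move: fG; rewrite (reduced_groebner_basis_uniq (@J_sub R n) redG red).
  by move=> /reduced_basisP[b cb ->]; rewrite (lm_reduced r_std) ?(corner_nonstandard cb).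
move=> ca; have /and3P[la _ _] := ca; pose b := Monom la.
exists (<< b >> - r b, b); split=> //; exists (reduced_basis n r); split=> //=.
  by apply/reduced_basisP; exists b.
by rewrite (lm_reduced r_std) ?(corner_nonstandard ca).
Qed.
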